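(* For every infinite binary sequence $\rho=\rho_0\rho_1\rho_2\cdots\in\mathcal{L}$, regarding $\rho$ as the real number in $[0,1]$ whose binary expansion is $0.\rho_0\rho_1\rho_2\ldots$ (the blocks concatenated), the sequence $(\{2^n\rho\})_{n\ge 1}$ of fractional parts does not have Poissonian pair correlations.
   Context: Work over the field $\mathbb{F}_2$; binary words are identified with vectors over $\mathbb{F}_2$, with coordinates indexed $1,\dots,e$. Define matrices $M_0=(1)$ and $M_{d+1}=\begin{pmatrix} M_d & M_d\\ 0 & M_d\end{pmatrix}$, so $M_d\in\mathbb{F}_2^{e\times e}$ with $e=2^d$. Let $w_0,\dots,w_{2^e-1}$ be all vectors of $\mathbb{F}_2^e$ in increasing lexicographic order ($w_n$ is the $e$-bit binary representation of $n$, most significant bit first). Let $\sigma$ be the rotation $\sigma(a_1\cdots a_n)=a_na_1\cdots a_{n-1}$. A tuple $\nu=(n_1,\dots,n_e)$ of non-negative integers is suitable if $n_e=0$ and $n_{i+1}\le n_i\le n_{i+1}+1$ for $1\le i\le e-1$. If $C_1,\dots,C_e$ are the columns of $M_d$, set $M_d^\nu=(\sigma^{n_1}(C_1),\dots,\sigma^{n_e}(C_e))$. A word is an $e$-affine necklace if it equals the concatenation $(Mw_0')(Mw_1')\cdots(Mw_{2^e-1}')$ for some $z\in\mathbb{F}_2^e$ and some suitable tuple $\nu$, where $M=M_d^\nu$ and $w_i'=w_i+z$. $\mathcal{L}$ is the set of infinite binary words $\rho_0\rho_1\rho_2\cdots$ where each $\rho_d$ is a $2^d$-affine necklace. For real $x$,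 $\{x\}=x-\lfloor x\rfloor$ and $\Vert x\Vert$ is the distance from $x$ to the nearest integer. A sequence $(x_n)_{n\ge1}$ in $[0,1)$ has Poissonian pair correlations if for every real $s\ge 0$, $\lim_{N\to\infty}F_N(s)=2s$, where $F_N(s)=\frac1N\#\{(i,j):1\le i\ne j\le N,\ \Vert x_i-x_j\Vert<s/N\}$. *)

(* Defs.v *)
(* binary words are lists of bools (F_2 = bool, + = xorb, * = andb). *)
From Stdlib Require Import Reals Lra Lia Arith List.
Import ListNotations.
Open Scope R_scope.

(* Entry (i,j) (0-indexed) of M_d: M_0 = (1), M_{d+1} = [[M_d, M_d],[0, M_d]]. *)
Fixpoint Ment (d i j : nat) : bool :=
  match d with
  | O => true
  | S d' => let h := (2 ^ d')%nat in
      if (i <? h)%nat then Ment d' i (if (j <? h)%nat then j else (j - h)%nat)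
      else if (j <? h)%nat then false else Ment d' (i - h)%nat (j - h)%nat
  end.

Definition Mcol (d j : nat) : list bool :=
  map (fun i => Ment d i j) (seq 0 (2 ^ d)).

Definition sigma (l : list bool) : list bool :=
  match l with
  | [] => []
  | _ => last l false :: removelast l
  end.

Definition sigma_pow (n : nat) (l : list bool) : list bool := Nat.iter n sigma l.

(* suitable tuple nu = (n_1,...,n_e), stored 0-indexed as a list of length e *)
Definition suitable (e : nat) (nu : list nat) : Prop :=
  length nu = e /\ nth (e - 1) nu 0%nat = 0%nat /\
  (forall i, (S i < e)%nat ->
     (nth (S i) nu 0 <= nth i nu 0 <= S (nth (S i) nu 0))%nat).

Definition Mnu (d : nat) (nu : list nat) : list (list bool) :=
  map (fun j => sigma_pow (nth j nu 0%nat) (Mcol d j)) (seq 0 (2 ^ d)).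

Definition mulcols (e : nat) (cols : list (list bool)) (w : list bool) : list bool :=
  map (fun i => fold_left xorb
         (map (fun j => andb (nth i (nth j cols []) false) (nth j w false)) (seq 0 e))
         false)
      (seq 0 e).

Definition wvec (e n : nat) : list bool :=
  map (fun i => Nat.testbit n (e - 1 - i)) (seq 0 e).

Definition vadd (u v : list bool) : list bool :=
  map (fun p => xorb (fst p) (snd p)) (combine u v).

Definition necklace_word (d : nat) (z : list bool) (nu : list nat) : list bool :=
  let e := (2 ^ d)%nat in
  flat_map (fun n => mulcols e (Mnu d nu) (vadd (wvec e n) z)) (seq 0 (2 ^ e)).

Definition affine_necklace (d : nat) (w : list bool) : Prop :=
  exists (z : list bool) (nu : list nat),
    length z = (2 ^ d)%nat /\ suitable (2 ^ d) nu /\ w = necklace_word d z nu.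

Definition in_L (rho : nat -> list bool) : Prop :=
  forall d, affine_necklace d (rho d).

(* k-th bit (0-indexed) of the concatenation rho_0 rho_1 rho_2 ... ;
   fuel k+1 suffices since every block is nonempty *)
Fixpoint get_bit (rho : nat -> list bool) (fuel d k : nat) : bool :=
  match fuel with
  | O => false
  | S f => let b := rho d in
      if (k <? length b)%nat then nth k b false
      else get_bit rho f (S d) (k - length b)%nat
  end.

Definition bit (rho : nat -> list bool) (k : nat) : bool := get_bit rho (S k) 0 k.

Definition digit_term (rho : nat -> list bool) (k : nat) : R :=
  if bit rho k then (/ 2) ^ (S k) else 0.

Definition dist_int (y : R) : R := Rmin (frac_part y) (1 - frac_part y).

Definition pair_count (x : nat -> R) (N : nat) (s : R) : nat :=
  length (filter (fun p =>
     if Nat.eq_dec (fst p) (snd p) then false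
     else if Rlt_dec (dist_int (x (fst p) - x (snd p))) (s / INR N) then true else false)
   (list_prod (seq 1 N) (seq 1 N))).

Definition F_N (x : nat -> R) (N : nat) (s : R) : R := INR (pair_count x N s) / INR N.

Definition poissonian_pair_correlations (x : nat -> R) : Prop :=
  forall s : R, 0 <= s -> Un_cv (fun N => F_N x N s) (2 * s).

(* Main.v *)
(** In a [2^d]-affine necklace with [e = 2^d] the last column of the matrix is
    constantly one (it is not rotated, as [n_e = 0]), so the blocks [M w'_{2k}]
    and [M w'_{2k+1}] are complementary.  Hence, at a position in the first half
    of [M w'_{2k}], the first [e] digits determine more than [e + d + 2] digits.
    With [e = 4c] there are [c 2^e] such positions but only [2^e] words of length
    [e], so at least [(c^2 - c) 2^e] ordered pairs of positions share
    [e + d + 2] digits and are at distance less than [1/N], where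
    [N <= 8 c 2^e] is the end of the necklace.  Thus [F_N 1] is unbounded. *)

Require Import Defs.
From Stdlib Require Import Reals List Lra Lia Arith ZArith Bool.
Import ListNotations.
Open Scope R_scope.

(** * Counting collisions *)

Lemma NoDup_list_prod {A B : Type} (l : list A) (l' : list B) :
  NoDup l -> NoDup l' -> NoDup (list_prod l l').
Proof.
  intros Hl Hl'; induction Hl as [|a l Ha Hl IH]; simpl; [constructor|].
  apply NoDup_app.
  - apply NoDup_map_NoDup_ForallPairs; [|exact Hl'].
    intros x y _ _ E; congruence.
  - exact IH.
  - intros [x y] H1 H2.
    apply in_map_iff in H1 as (z & E & _); injection E as <- <-.
    apply in_prod_iff in H2 as [H2 _]; contradiction.
Qed.

(** Ordered pairs with the diagonal kept, so in a duplicate-free list a fibre of [m] elements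
    contributes exactly [m * m]. *)
Definition collisions {A : Type} (f : A -> nat) (l : list A) : list (A * A) :=
  filter (fun p => (f (fst p) =? f (snd p))%nat) (list_prod l l).

Lemma in_collisions {A : Type} (f : A -> nat) (l : list A) i j :
  In (i, j) (collisions f l) <-> In i l /\ In j l /\ f i = f j.
Proof.
  unfold collisions; rewrite filter_In, in_prod_iff; simpl.
  rewrite Nat.eqb_eq; tauto.
Qed.

(* The tangent-line bound [2 c m <= m^2 + c^2] on each fibre replaces
   the Cauchy-Schwarz inequality. *)
Lemma collisions_lower_bound {A : Type} (f : A -> nat) (c K : nat) (l : list A) :
  NoDup l -> (forall i, In i l -> (f i < K)%nat) ->
  (2 * c * length l <= length (collisions f l) + c * c * K)%nat.
Proof.
  revert l; induction K as [|K IH]; intros l Hl Hf.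
  - destruct l as [|a l]; [simpl; lia|].
    specialize (Hf a (or_introl eq_refl)); lia.
  - set (l1 := filter (fun i => (f i <? K)%nat) l).
    set (l2 := filter (fun i => negb (f i <? K)%nat) l).
    assert (Hl1 : NoDup l1) by (apply NoDup_filter; exact Hl).
    assert (Hl2 : NoDup l2) by (apply NoDup_filter; exact Hl).
    assert (Hin1 : forall i, In i l1 -> In i l /\ (f i < K)%nat).
    { intros i; unfold l1; rewrite filter_In, Nat.ltb_lt; tauto. }
    assert (Hin2 : forall i, In i l2 -> In i l /\ f i = K).
    { intros i; unfold l2; rewrite filter_In, negb_true_iff, Nat.ltb_ge.
      intros [Hi Hk]; split; [exact Hi|]; specialize (Hf i Hi); lia. }
    assert (Hlen : (length l1 + length l2 = length l)%nat)
      by apply filter_length.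
    (* Collisions with label below [K] and the full square of the fibre over [K] are disjoint sets
       of collisions of [l]. *)
    assert (Hc : (length (collisions f l1) + length l2 * length l2
                  <= length (collisions f l))%nat).
    { rewrite <- length_prod, <- length_app.
      apply NoDup_incl_length.
      - apply NoDup_app.
        + apply NoDup_filter, NoDup_list_prod; exact Hl1.
        + apply NoDup_list_prod; exact Hl2.
        + intros [i j] H1 H2.
          apply in_collisions in H1 as [H1 _]; apply in_prod_iff in H2 as [H2 _].
          apply Hin1 in H1; apply Hin2 in H2; lia.
      - intros [i j]; rewrite in_app_iff, !in_collisions, in_prod_iff.
        intros [(H1 & H2 & E)|[H1 H2]].
        + apply Hin1 in H1; apply Hin1 in H2; tauto.
        + apply Hin2 in H1; apply Hin2 in H2.
          repeat split; try tauto; lia. }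
    specialize (IH l1 Hl1 (fun i Hi => proj2 (Hin1 i Hi))).
    assert (2 * c * length l2 <= length l2 * length l2 + c * c)%nat.
    (* This is the nonnegativity of [(length l2 - c)^2]; [q] is the larger number minus the smaller,
       which avoids truncated subtraction. *)
    { destruct (Nat.le_ge_cases c (length l2)) as [H|H];
        apply Nat.le_exists_sub in H as (q & -> & _); nia. }
    nia.
Qed.

Lemma collisions_off_diagonal (f : nat -> nat) (l : list nat) :
  NoDup l ->
  (length (collisions f l)
   <= length (filter (fun p => negb (fst p =? snd p)%nat) (collisions f l))
      + length l)%nat.
Proof.
  intros Hl.
  rewrite <- (filter_length (fun p => negb (fst p =? snd p)%nat) (collisions f l)).
  apply Nat.add_le_mono_l.
  rewrite <- (length_map (fun i => (i, i)) l).
  apply NoDup_incl_length.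
  - apply NoDup_filter, NoDup_filter, NoDup_list_prod; exact Hl.
  - intros [i j]; rewrite filter_In, in_collisions, in_map_iff; simpl.
    rewrite negb_involutive, Nat.eqb_eq.
    intros [[Hi _] ->]; exists j; auto.
Qed.

(** Only [K] labels are available, and equal labels force close points. The term [length l] pays for
    the diagonal, which [pair_count] excludes. *)
Lemma pair_count_lower_bound (x : nat -> R) (N : nat) (s : R)
    (f : nat -> nat) (c K : nat) (l : list nat) :
  NoDup l -> (forall i, In i l -> (1 <= i <= N)%nat /\ (f i < K)%nat) ->
  (forall i j, In i l -> In j l -> f i = f j ->
     dist_int (x i - x j) < s / INR N) ->
  (2 * c * length l <= pair_count x N s + length l + c * c * K)%nat.
Proof.
  intros Hl Hf Hd.
  pose proof (collisions_lower_bound f c K l Hl (fun i Hi => proj2 (Hf i Hi))) as H1.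
  pose proof (collisions_off_diagonal f l Hl) as H2.
  enough (length (filter (fun p => negb (fst p =? snd p)%nat) (collisions f l))
          <= pair_count x N s)%nat by lia.
  unfold pair_count; apply NoDup_incl_length.
  - apply NoDup_filter, NoDup_filter, NoDup_list_prod; exact Hl.
  - intros [i j]; rewrite !filter_In, in_collisions, in_prod_iff, !in_seq; simpl.
    rewrite negb_true_iff, Nat.eqb_neq.
    intros [(Hi & Hj & E) Hij].
    destruct (Hf i Hi) as [? _]; destruct (Hf j Hj) as [? _].
    split; [lia|].
    destruct (Nat.eq_dec i j); [contradiction|].
    destruct (Rlt_dec (dist_int (x i - x j)) (s / INR N)) as [|Hge]; [reflexivity|].
    exfalso; apply Hge, Hd; assumption.
Qed.

(** * Binary expansions *)

(** The integer whose binary digits, most significant first, are the [L] values of [b] from position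
    [n] on. *)
Fixpoint window (b : nat -> bool) (n L : nat) : nat :=
  match L with
  | O => 0%nat
  | S L' => (2 * window b n L' + Nat.b2n (b (n + L')))%nat
  end.

Lemma window_lt (b : nat -> bool) (n L : nat) : (window b n L < 2 ^ L)%nat.
Proof.
  induction L as [|L IH]; simpl; [lia|].
  destruct (b (n + L)%nat); simpl; lia.
Qed.

Lemma window_eq_bits (b : nat -> bool) (n m L : nat) :
  window b n L = window b m L <->
  (forall t, (t < L)%nat -> b (n + t)%nat = b (m + t)%nat).
Proof.
  induction L as [|L IH]; simpl.
  - split; [intros; lia|reflexivity].
  - split.
    + intros E t Ht.
      assert (window b n L = window b m L /\ b (n + L)%nat = b (m + L)%nat)
        as [E1 E2].
      { destruct (b (n + L)%nat), (b (m + L)%nat); simpl in E;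
          split; solve [reflexivity | lia]. }
      destruct (Nat.eq_dec t L) as [->|]; [exact E2|].
      apply IH; [exact E1|lia].
    + intros H; rewrite (proj2 IH) by (intros; apply H; lia).
      rewrite (H L) by lia; reflexivity.
Qed.

Lemma window_add (b : nat -> bool) (n L : nat) :
  window b 0 (n + L) = (2 ^ L * window b 0 n + window b n L)%nat.
Proof.
  induction L as [|L IH]; simpl.
  - rewrite Nat.add_0_r; lia.
  - rewrite Nat.add_succ_r; simpl; rewrite IH; lia.
Qed.

Lemma digit_sum_window (rho : nat -> list bool) (n : nat) :
  2 ^ S n * sum_f_R0 (digit_term rho) n = INR (window (bit rho) 0 (S n)).
Proof.
  assert (D : forall k, 2 ^ S k * digit_term rho k = INR (Nat.b2n (bit rho k))).
  { intros k; unfold digit_term; destruct (bit rho k); simpl Nat.b2n.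
    - rewrite <- Rpow_mult_distr, Rinv_r, pow1 by lra; reflexivity.
    - simpl INR; ring. }
  induction n as [|n IH].
  - simpl sum_f_R0; rewrite D; reflexivity.
  - change (window (bit rho) 0 (S (S n)))
      with (2 * window (bit rho) 0 (S n) + Nat.b2n (bit rho (S n)))%nat.
    rewrite plus_INR, mult_INR, <- IH, <- D; simpl; ring.
Qed.

(** Partial sums reaching index [n] satisfy both bounds, since the digits from position [n] on
    contribute between 0 and 1 after scaling; weak inequalities survive the limit. The upper bound
    is attained when all those digits are 1. *)
Lemma infinite_sum_expansion_bounds (rho : nat -> list bool) (x : R) (n : nat) :
  infinite_sum (digit_term rho) x ->
  INR (window (bit rho) 0 n) <= 2 ^ n * x <= INR (window (bit rho) 0 n) + 1.
Proof.
  intros Hx.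
  assert (P : forall k, 0 < 2 ^ k) by (intros; apply pow_lt; lra).
  assert (B : forall m, (n <= m)%nat ->
    INR (window (bit rho) 0 n) <= 2 ^ n * sum_f_R0 (digit_term rho) m <= INR (window (bit rho) 0 n) + 1).
  { intros m Hm.
    set (s := sum_f_R0 (digit_term rho) m).
    assert (E : 2 ^ S m * s = INR (window (bit rho) 0 (S m))) by apply digit_sum_window.
    replace (S m) with (n + (S m - n))%nat in E by lia.
    set (L := (S m - n)%nat) in E.
    rewrite window_add, plus_INR, mult_INR, pow_INR, pow_add in E.
    change (INR 2) with 2 in E.
    assert (H0 : 0 <= INR (window (bit rho) n L)) by apply pos_INR.
    assert (H1 : INR (window (bit rho) n L) <= 2 ^ L).
    { change 2 with (INR 2); rewrite <- pow_INR.
      apply le_INR; pose proof (window_lt (bit rho) n L); lia. }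
    pose proof (P L).
    split; apply (Rmult_le_reg_l (2 ^ L)); try lra; nra. }
  assert (Hn := P n).
  split.
  - apply Rnot_lt_le; intros Hlt.
    (* The gap left by a violated bound, scaled back by [2 ^ n], serves as the epsilon of
       convergence. *)
    destruct (Hx ((INR (window (bit rho) 0 n) - 2 ^ n * x) / 2 ^ n)) as [M HM].
    { apply Rdiv_lt_0_compat; lra. }
    specialize (HM (n + M)%nat ltac:(lia)); specialize (B (n + M)%nat ltac:(lia)).
    unfold Rdist in HM; apply Rabs_def2 in HM as [HM _].
    apply (Rmult_lt_compat_l (2 ^ n)) in HM; [|exact Hn].
    unfold Rdiv in HM; rewrite (Rmult_comm _ (/ 2 ^ n)), <- Rmult_assoc, Rinv_r in HM
      by lra.
    lra.
  - apply Rnot_lt_le; intros Hlt.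
    destruct (Hx ((2 ^ n * x - (INR (window (bit rho) 0 n) + 1)) / 2 ^ n)) as [M HM].
    { apply Rdiv_lt_0_compat; lra. }
    specialize (HM (n + M)%nat ltac:(lia)); specialize (B (n + M)%nat ltac:(lia)).
    unfold Rdist in HM; apply Rabs_def2 in HM as [_ HM].
    apply (Rmult_lt_compat_l (2 ^ n)) in HM; [|exact Hn].
    unfold Rdiv in HM; rewrite <- Ropp_mult_distr_r, (Rmult_comm _ (/ 2 ^ n)),
      <- Rmult_assoc, Rinv_r in HM by lra.
    lra.
Qed.

Lemma dist_int_le (y : R) (m : Z) : dist_int y <= Rabs (y - IZR m).
Proof.
  unfold dist_int, frac_part.
  destruct (Z.le_gt_cases m (Int_part y)) as [H|H].
  - apply IZR_le in H.
    eapply Rle_trans; [apply Rmin_l|].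
    eapply Rle_trans; [|apply Rle_abs]; lra.
  - assert (H' : (Int_part y + 1 <= m)%Z) by lia.
    apply IZR_le in H'; rewrite plus_IZR in H'.
    eapply Rle_trans; [apply Rmin_r|].
    rewrite Rabs_minus_sym.
    eapply Rle_trans; [|apply Rle_abs]; lra.
Qed.

Lemma dist_int_common_window (rho : nat -> list bool) (x : R) (i j L : nat) :
  infinite_sum (digit_term rho) x ->
  window (bit rho) i L = window (bit rho) j L ->
  dist_int (frac_part (2 ^ i * x) - frac_part (2 ^ j * x)) <= / 2 ^ L.
Proof.
  intros Hx E.
  assert (HL : 0 < 2 ^ L) by (apply pow_lt; lra).
  pose proof (infinite_sum_expansion_bounds rho x (i + L) Hx) as Hi.
  pose proof (infinite_sum_expansion_bounds rho x (j + L) Hx) as Hj.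
  rewrite window_add, plus_INR, mult_INR, pow_INR, pow_add in Hi, Hj.
  rewrite <- E in Hj; change (INR 2) with 2 in Hi, Hj.
  set (a := window (bit rho) 0 i) in *; set (b := window (bit rho) 0 j) in *.
  set (v := INR (window (bit rho) i L)) in *.
  eapply Rle_trans.
  (* With this integer the difference becomes [(2^i x - a) - (2^j x - b)], and both terms lie in the
     interval from [v / 2^L] to [(v + 1) / 2^L]. The prefix [a] may differ from the integer part
     when the digits end in all ones. *)
  - apply (dist_int_le _ (Z.of_nat a - Int_part (2 ^ i * x)
                          - (Z.of_nat b - Int_part (2 ^ j * x)))).
  - unfold frac_part; rewrite !minus_IZR, <- !INR_IZR_INZ.
    apply (Rmult_le_reg_l (2 ^ L)); [exact HL|].
    rewrite Rinv_r by lra.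
    rewrite <- (Rabs_pos_eq (2 ^ L)) at 1 by lra.
    rewrite <- Rabs_mult.
    apply Rabs_le; lra.
Qed.

(** * Affine necklaces *)

Lemma nth_flat_map_const {A B : Type} (g : A -> list B) (e : nat) (l : list A)
    (a0 : A) (b0 : B) (k r : nat) :
  (forall a, length (g a) = e) -> (k < length l)%nat -> (r < e)%nat ->
  nth (k * e + r) (flat_map g l) b0 = nth r (g (nth k l a0)) b0.
Proof.
  intros Hg; revert k; induction l as [|a l IH]; simpl; intros k Hk Hr; [lia|].
  destruct k as [|k].
  - apply app_nth1; rewrite Hg; exact Hr.
  - rewrite app_nth2 by (rewrite Hg; simpl; lia).
    rewrite <- IH by lia; f_equal; rewrite Hg; simpl; lia.
Qed.

Lemma length_mulcols (e : nat) cols w : length (mulcols e cols w) = e.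
Proof. unfold mulcols; rewrite length_map; apply length_seq. Qed.

Lemma length_necklace_word (d : nat) z nu :
  length (necklace_word d z nu) = (2 ^ d * 2 ^ (2 ^ d))%nat.
Proof.
  unfold necklace_word.
  rewrite (flat_map_constant_length (c := (2 ^ d)%nat)), length_seq.
  - lia.
  - intros; apply length_mulcols.
Qed.

Lemma nth_map_seq {A : Type} (f : nat -> A) (n i : nat) (a : A) :
  (i < n)%nat -> nth i (map f (seq 0 n)) a = f i.
Proof.
  intros Hi; rewrite (nth_indep _ a (f 0%nat)) by (rewrite length_map, length_seq; exact Hi).
  rewrite map_nth, seq_nth by exact Hi; reflexivity.
Qed.

(** The last column runs through the two right-hand quadrants, both copies of the smaller matrix,
    along their own last column. *)
Lemma Ment_last_column (d i : nat) :
  (i < 2 ^ d)%nat -> Ment d i (2 ^ d - 1) = true.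
Proof.
  revert i; induction d as [|d IH]; intros i Hi; [reflexivity|].
  cbn [Ment]; rewrite Nat.pow_succ_r' in *.
  assert (0 < 2 ^ d)%nat by (apply Nat.neq_0_lt_0, Nat.pow_nonzero; lia).
  replace (2 * 2 ^ d - 1 <? 2 ^ d)%nat with false
    by (symmetry; apply Nat.ltb_ge; lia).
  replace (2 * 2 ^ d - 1 - 2 ^ d)%nat with (2 ^ d - 1)%nat by lia.
  destruct (Nat.ltb_spec i (2 ^ d)); apply IH; lia.
Qed.

Lemma nth_vadd (u v : list bool) (i : nat) :
  length u = length v ->
  nth i (vadd u v) false = xorb (nth i u false) (nth i v false).
Proof.
  intros E; unfold vadd.
  change false with ((fun p : bool * bool => xorb (fst p) (snd p)) (false, false)) at 1.
  rewrite map_nth, combine_nth by exact E; reflexivity.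
Qed.

Lemma nth_wvec (e n i : nat) :
  (i < e)%nat -> nth i (wvec e n) false = Nat.testbit n (e - 1 - i).
Proof. intros Hi; unfold wvec; rewrite nth_map_seq by exact Hi; reflexivity. Qed.

Lemma length_wvec (e n : nat) : length (wvec e n) = e.
Proof. unfold wvec; rewrite length_map; apply length_seq. Qed.

(** The vectors for [2k] and [2k + 1] differ only in the last coordinate, also after adding [z], so
    the two products differ by the last column, which is all ones. *)
Lemma mulcols_consecutive_complement (d : nat) (z : list bool) (nu : list nat)
    (k r : nat) :
  length z = (2 ^ d)%nat -> suitable (2 ^ d) nu -> (r < 2 ^ d)%nat ->
  nth r (mulcols (2 ^ d) (Mnu d nu) (vadd (wvec (2 ^ d) (2 * k + 1)) z)) false =
  negb (nth r (mulcols (2 ^ d) (Mnu d nu) (vadd (wvec (2 ^ d) (2 * k)) z)) false).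
Proof.
  intros Hz (_ & Hnu & _) Hr; unfold mulcols.
  rewrite !nth_map_seq by exact Hr.
  assert (Hlast : nth r (nth (2 ^ d - 1) (Mnu d nu) []) false = true).
  { unfold Mnu; rewrite nth_map_seq, Hnu by lia.
    unfold sigma_pow, Mcol; simpl Nat.iter.
    rewrite nth_map_seq by exact Hr; apply Ment_last_column; exact Hr. }
  set (e := (2 ^ d)%nat) in *.
  assert (Hw : forall n j, (j < e)%nat ->
    nth j (vadd (wvec e n) z) false
    = xorb (Nat.testbit n (e - 1 - j)) (nth j z false)).
  { intros n j Hj; rewrite nth_vadd, nth_wvec; rewrite ?length_wvec; auto. }
  assert (Hs : seq 0 e = seq 0 (e - 1) ++ [(e - 1)%nat]).
  { replace e with (e - 1 + 1)%nat at 1 by lia; apply seq_app. }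
  rewrite Hs, !map_app, !fold_left_app; simpl.
  rewrite Hlast, !Hw, Nat.sub_diag by lia.
  change (k + (k + 0))%nat with (2 * k)%nat.
  rewrite Nat.testbit_odd_0, Nat.testbit_even_0.
  (* Coordinates before the last read binary digits of positive index, where [2k] and [2k + 1]
     agree. *)
  assert (E : forall m, (m <= e - 1)%nat ->
    map (fun j => nth r (nth j (Mnu d nu) []) false
                  && nth j (vadd (wvec e (2 * k + 1)) z) false) (seq 0 m)
    = map (fun j => nth r (nth j (Mnu d nu) []) false
                  && nth j (vadd (wvec e (2 * k)) z) false) (seq 0 m)).
  { intros m Hm; apply map_ext_in; intros j Hj; apply in_seq in Hj.
    rewrite !Hw by lia.
    replace (e - 1 - j)%nat with (S (e - 2 - j)) by lia.
    rewrite Nat.testbit_odd_succ', Nat.testbit_even_succ'; reflexivity. }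
  rewrite E by lia; simpl.
  destruct (fold_left _ _ _), (nth (e - 1) z false); reflexivity.
Qed.

Lemma necklace_word_complement (d : nat) (w : list bool) (k r : nat) :
  affine_necklace d w -> (2 * k + 1 < 2 ^ (2 ^ d))%nat -> (r < 2 ^ d)%nat ->
  nth ((2 * k + 1) * 2 ^ d + r) w false = negb (nth (2 * k * 2 ^ d + r) w false).
Proof.
  intros (z & nu & Hz & Hnu & ->) Hk Hr; unfold necklace_word.
  rewrite !(nth_flat_map_const _ (2 ^ d) _ 0%nat);
    try (intros; apply length_mulcols); rewrite ?length_seq; try lia.
  rewrite !seq_nth by lia.
  rewrite !Nat.add_0_l; apply mulcols_consecutive_complement; assumption.
Qed.

(** * Position of the necklaces in the expansion *)

(** Start of block [d0 + m] measured from the start of block [d0]; the base [d0] varies because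
    [get_bit] recurses by advancing it. *)
Fixpoint block_offset (rho : nat -> list bool) (d0 m : nat) : nat :=
  match m with
  | O => 0%nat
  | S m' => (length (rho d0) + block_offset rho (S d0) m')%nat
  end.

Lemma block_offset_succ_r (rho : nat -> list bool) (d0 m : nat) :
  block_offset rho d0 (S m) = (block_offset rho d0 m + length (rho (d0 + m)))%nat.
Proof.
  revert d0; induction m as [|m IH]; intros d0.
  - simpl; rewrite !Nat.add_0_r; reflexivity.
  - change (block_offset rho d0 (S (S m)))
      with (length (rho d0) + block_offset rho (S d0) (S m))%nat.
    rewrite IH, Nat.add_succ_comm; simpl; lia.
Qed.

Lemma get_bit_block (rho : nat -> list bool) (fuel d0 m q : nat) :
  (m < fuel)%nat -> (q < length (rho (d0 + m)))%nat ->
  get_bit rho fuel d0 (block_offset rho d0 m + q) = nth q (rho (d0 + m)%nat) false.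
Proof.
  revert fuel d0; induction m as [|m IH]; intros fuel d0 Hf Hq;
    destruct fuel as [|fuel]; try lia; simpl.
  - rewrite Nat.add_0_r in *.
    rewrite (proj2 (Nat.ltb_lt _ _) Hq); reflexivity.
  - replace (_ <? _)%nat with false by (symmetry; apply Nat.ltb_ge; lia).
    rewrite Nat.add_succ_r in *.
    replace (_ + _ - _)%nat with (block_offset rho (S d0) m + q)%nat by lia.
    apply (IH fuel (S d0)); [lia|exact Hq].
Qed.

Lemma length_block (rho : nat -> list bool) (d : nat) :
  in_L rho -> length (rho d) = (2 ^ d * 2 ^ (2 ^ d))%nat.
Proof.
  intros H; destruct (H d) as (z & nu & _ & _ & ->); apply length_necklace_word.
Qed.

(** Every block is nonempty. This makes the fuel in [bit] sufficient and lets necklace ends exceed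
    any given bound. *)
Lemma block_offset_ge (rho : nat -> list bool) (d : nat) :
  in_L rho -> (d <= block_offset rho 0 d)%nat.
Proof.
  intros H; induction d as [|d IH]; [lia|].
  rewrite block_offset_succ_r, length_block by exact H.
  simpl Nat.add.
  assert (2 ^ d <> 0 /\ 2 ^ 2 ^ d <> 0)%nat by (split; apply Nat.pow_nonzero; lia).
  nia.
Qed.

(** Each block is at least twice as long as its predecessor, so all blocks up to the last total at
    most twice the last. *)
Lemma block_offset_le (rho : nat -> list bool) (d : nat) :
  in_L rho -> (block_offset rho 0 (S d) <= 2 * (2 ^ d * 2 ^ (2 ^ d)))%nat.
Proof.
  intros H; induction d as [|d IH].
  - simpl; rewrite length_block by exact H; simpl; lia.
  - rewrite block_offset_succ_r, length_block by exact H.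
    simpl (0 + S d)%nat.
    enough (2 * (2 ^ d * 2 ^ 2 ^ d) <= 2 ^ S d * 2 ^ 2 ^ S d)%nat by lia.
    rewrite Nat.pow_succ_r', <- Nat.mul_assoc.
    apply Nat.mul_le_mono_l, Nat.mul_le_mono_l, Nat.pow_le_mono_r; lia.
Qed.

Lemma bit_block (rho : nat -> list bool) (d q : nat) :
  in_L rho -> (q < length (rho d))%nat ->
  bit rho (block_offset rho 0 d + q) = nth q (rho d) false.
Proof.
  intros H Hq; unfold bit; apply (get_bit_block rho _ 0).
  - pose proof (block_offset_ge rho d H); lia.
  - exact Hq.
Qed.

(** Offsets [r < h] inside the even-indexed blocks [2k], for [k < m], of a necklace starting at [P]
    with blocks of length [e]. *)
Definition half_block_positions (P e m h : nat) : list nat :=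
  map (fun p => (P + 2 * fst p * e + snd p)%nat) (list_prod (seq 0 m) (seq 0 h)).

Lemma in_half_block_positions (P e m h i : nat) :
  In i (half_block_positions P e m h) ->
  exists k r, (k < m)%nat /\ (r < h)%nat /\ i = (P + 2 * k * e + r)%nat.
Proof.
  unfold half_block_positions; rewrite in_map_iff.
  intros ([k r] & <- & Hp).
  apply in_prod_iff in Hp as [H1 H2]; apply in_seq in H1, H2.
  exists k, r; simpl; repeat split; lia.
Qed.

Lemma length_half_block_positions (P e m h : nat) :
  length (half_block_positions P e m h) = (m * h)%nat.
Proof.
  unfold half_block_positions; rewrite length_map, length_prod, !length_seq; reflexivity.
Qed.

Lemma NoDup_half_block_positions (P e m h : nat) :
  (h <= e)%nat -> NoDup (half_block_positions P e m h).
Proof.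
  intros He; apply NoDup_map_NoDup_ForallPairs;
    [|apply NoDup_list_prod; apply seq_NoDup].
  intros [k r] [k' r'] H1 H2 E; simpl in E.
  apply in_prod_iff in H1 as [_ H1], H2 as [_ H2]; apply in_seq in H1, H2.
  assert (k = k') as -> by nia.
  f_equal; lia.
Qed.

(** A shift by [e] moves a position of block [2k] to the same offset in block [2k + 1], where the
    digit is complemented. As long as [r + t < e], the digit at [e + t] is thus determined by the
    digit at [t]. *)
Lemma half_block_window_extends (rho : nat -> list bool) (d L : nat)
    (k r k' r' : nat) :
  in_L rho ->
  let e := (2 ^ d)%nat in
  let P := block_offset rho 0 d in
  (2 * k + 1 < 2 ^ e)%nat -> (2 * k' + 1 < 2 ^ e)%nat ->
  (r + L <= e)%nat -> (r' + L <= e)%nat ->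
  window (bit rho) (P + 2 * k * e + r) e = window (bit rho) (P + 2 * k' * e + r') e ->
  window (bit rho) (P + 2 * k * e + r) (e + L)
  = window (bit rho) (P + 2 * k' * e + r') (e + L).
Proof.
  intros H e P Hk Hk' Hr Hr' E.
  assert (C : forall k r t, (2 * k + 1 < 2 ^ e)%nat -> (r + t < e)%nat ->
    bit rho (P + 2 * k * e + r + (e + t))
    = negb (bit rho (P + 2 * k * e + r + t))).
  { clear - H; intros k r t Hk Hr.
    replace (P + 2 * k * e + r + (e + t))%nat
      with (P + ((2 * k + 1) * e + (r + t)))%nat by lia.
    replace (P + 2 * k * e + r + t)%nat with (P + (2 * k * e + (r + t)))%nat by lia.
    unfold P; rewrite !bit_block; try exact H;
      try (rewrite length_block by exact H; fold e; nia).
    apply necklace_word_complement; auto. }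
  rewrite window_eq_bits in *; intros t Ht.
  destruct (Nat.lt_ge_cases t e) as [Hte|Hte]; [apply E; exact Hte|].
  apply Nat.le_exists_sub in Hte as (q & -> & _).
  rewrite (Nat.add_comm q e), !C by lia.
  f_equal; apply E; lia.
Qed.

(** Windows of length [e] label the [c * 2^e] first-half positions with [2^e] values; the collision
    bound with parameter [c], their mean multiplicity, gives the estimate. *)
Lemma pair_count_end_of_block (rho : nat -> list bool) (x : R) (d c : nat) :
  in_L rho -> infinite_sum (digit_term rho) x ->
  (2 ^ d = 4 * c)%nat -> (1 <= d)%nat -> (d + 2 <= 2 * c)%nat ->
  (c * c * 2 ^ (2 ^ d) <=
   pair_count (fun n => frac_part (2 ^ n * x)) (block_offset rho 0 (S d)) 1
   + c * 2 ^ (2 ^ d))%nat.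
Proof.
  intros H Hx He Hd Hc.
  pose proof (block_offset_ge rho d H) as HP.
  pose proof (block_offset_le rho d H) as HN.
  pose proof (block_offset_succ_r rho 0 d) as HS.
  rewrite length_block in HS by exact H; simpl Nat.add in HS.
  set (N := block_offset rho 0 (S d)) in *.
  set (P := block_offset rho 0 d) in *.
  set (e := (2 ^ d)%nat) in *.
  set (m := (2 ^ (e - 1))%nat).
  assert (Hm : (2 ^ e = 2 * m)%nat).
  { unfold m; rewrite <- Nat.pow_succ_r'; f_equal; lia. }
  set (l := half_block_positions P e m (2 * c)).
  assert (Hl : length l = (c * 2 ^ e)%nat).
  { unfold l; rewrite length_half_block_positions, Hm; lia. }
  enough (2 * c * length l
    <= pair_count (fun n => frac_part (2 ^ n * x)) N 1 + length l + c * c * 2 ^ e)%nat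
    by (rewrite Hl in *; nia).
  apply (pair_count_lower_bound _ _ _ (fun n => window (bit rho) n e)).
  - apply NoDup_half_block_positions; lia.
  - intros i Hi; split; [|apply window_lt].
    apply in_half_block_positions in Hi as (k & r & Hk & Hr & ->).
    rewrite HS, Hm; nia.
  - intros i j Hi Hj E.
    apply in_half_block_positions in Hi as (k & r & Hk & Hr & ->).
    apply in_half_block_positions in Hj as (k' & r' & Hk' & Hr' & ->).
    (* Offsets are below [2 * c = e / 2], so [d + 2 <= 2 * c] leaves room for the extra digits in
       the block. *)
    apply (half_block_window_extends rho d (d + 2)) in E;
      fold e P; try lia; try exact H.
    eapply Rle_lt_trans; [apply (dist_int_common_window rho); eassumption|].
    unfold Rdiv; rewrite Rmult_1_l.
    apply Rinv_lt_contravar.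
    + apply Rmult_lt_0_compat; [|apply pow_lt; lra].
      apply lt_0_INR; lia.
    (* Here [2^(e + d + 2) = 4 * e * 2^e], whereas [N <= 2 * e * 2^e]. *)
    + change 2 with (INR 2); rewrite <- pow_INR; apply lt_INR.
      rewrite !Nat.pow_add_r; fold e.
      assert (e * 2 ^ e <> 0)%nat
        by (apply Nat.neq_mul_0; split; [lia|apply Nat.pow_nonzero; lia]).
      change (2 ^ 2)%nat with 4%nat; lia.
Qed.

Theorem theorem1 (rho : nat -> list bool) (Hrho : in_L rho)
  (x : R) (Hx : infinite_sum (digit_term rho) x) :
  ~ poissonian_pair_correlations (fun n => frac_part (2 ^ n * x)).
Proof.
  intros Hpp.
  (* With [s = 1] and tolerance 1, the limit 2 would force [F_N 1 < 3] for all [N >= N0]. *)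
  destruct (Hpp 1 Rle_0_1 1 Rlt_0_1) as [N0 HN0].
  (* The necklace used has index [d + 2], so that its block length is [4 * c]; the summand 6 makes
     [c] at least 64. *)
  set (d := (N0 + 6)%nat).
  set (c := (2 ^ d)%nat).
  assert (Hdc : (d < c)%nat) by (apply Nat.pow_gt_lin_r; lia).
  assert (Hc : (64 <= c)%nat).
  { change 64%nat with (2 ^ 6)%nat; apply Nat.pow_le_mono_r; unfold d; lia. }
  assert (He : (2 ^ (d + 2) = 4 * c)%nat).
  { rewrite Nat.pow_add_r; fold c; change (2 ^ 2)%nat with 4%nat; lia. }
  pose proof (pair_count_end_of_block rho x (d + 2) c Hrho Hx He
                ltac:(lia) ltac:(lia)) as HC.
  pose proof (block_offset_ge rho (S (d + 2)) Hrho) as HN1.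
  pose proof (block_offset_le rho (d + 2) Hrho) as HN2.
  set (N := block_offset rho 0 (S (d + 2))) in *.
  specialize (HN0 N ltac:(unfold d in HN1; lia)).
  unfold Rdist, F_N in HN0; apply Rabs_def2 in HN0 as [HN0 _].
  rewrite He in HC, HN2.
  set (K := (2 ^ (4 * c))%nat) in *.
  set (C := pair_count _ N 1) in *.
  (* From [N <= 8 * c * K] and [C >= (c * c - c) * K], it suffices that [24 * c <= c * c - c], that
     is [c >= 25]. *)
  assert (HCN : (3 * N <= C)%nat) by nia.
  apply le_INR in HCN; rewrite mult_INR in HCN; simpl (INR 3) in HCN.
  assert (HN : 0 < INR N) by (apply lt_0_INR; lia).
  assert (3 <= INR C / INR N).
  { apply (Rmult_le_reg_r (INR N)); [exact HN|].
    unfold Rdiv; rewrite Rmult_assoc, Rinv_l; lra. }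
  lra.
Qed.
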